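(* Let $q$ be a prime power and let $\eta\in[0,2\pi)$. None of mixed $\mathrm{Bil}_{d\times e}(q)$, mixed $\mathrm{Alt}_n(q)$ for $n\ge4$, mixed $\mathrm{Her}_n(q^2)$ and mixed $\mathrm{Sym}_n(q)$, equipped with an $\eta$-function, are periodic.
   Context: A mixed graph $G=(V,\mathcal{A})$ consists of a finite vertex set $V$ and a subset $\mathcal{A} \subset V\times V \setminus \{(x,x) \mid x\in V\}$ of arcs. For an arc $a=(x,y)$, write $o(a)=x$, $t(a)=y$, $a^{-1}=(y,x)$. Let $\mathcal{A}^{-1}=\{a^{-1} \mid a\in\mathcal{A}\}$ and $\mathcal{A}^{\pm}=\mathcal{A}\cup\mathcal{A}^{-1}$. The underlying graph $G^{\pm}=(V,\mathcal{A}^{\pm})$ is regarded as an undirected simple graph, and $\deg_G x=\deg_{G^{\pm}}x$. For an undirected graph $\Gamma$, a mixed graph $G$ is called a mixed $\Gamma$ if $G^{\pm}$ is isomorphic to $\Gamma$. The sesquilinear forms graphs are the following undirected graphs. - $\mathrm{Bil}_{d\times e}(q)$: vertex set $\mathbb{F}_q^{d\times e}$ (all $d\times e$ matrices over $\mathbb{F}_q$), $M,N$ adjacent iff $\operatorname{rank}(M-N)=1$. It has $q^{de}$ vertices and valency $\frac{(q^d-1)(q^e-1)}{q-1}$. - $\mathrm{Alt}_n(q)$: vertex set the alternating matrices in $\mathbb{F}_q^{n\times n}$ (i.e. $M^{\top}=-M$ with zero diagonal), $M,N$ adjacent iff $\operatorname{rank}(M-N)=2$. It has $q^{n(n-1)/2}$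 vertices and valency $\frac{(q^n-1)(q^{n-1}-1)}{q^2-1}$. - $\mathrm{Her}_n(q^2)$: vertex set $\{M\in\mathbb{F}_{q^2}^{n\times n}\mid M^*=M\}$, where $M^*$ is the transpose of the matrix obtained by applying $x\mapsto x^q$ to all entries; $M,N$ adjacent iff $\operatorname{rank}(M-N)=1$. It has $q^{n^2}$ vertices and valency $\frac{q^{2n}-1}{q+1}$. - $\mathrm{Sym}_n(q)$: vertex set $\{M\in\mathbb{F}_q^{n\times n}\mid M^{\top}=M\}$, $M,N$ adjacent iff $\operatorname{rank}(M-N)=1$. It has $q^{n(n+1)/2}$ vertices and valency $q^n-1$. The $\eta$-function $\theta:\mathcal{A}^{\pm}\to\mathbb{R}$ of $G$ is defined by $\theta(a)=\eta$ if $a\in\mathcal{A}\setminus\mathcal{A}^{-1}$, $\theta(a)=-\eta$ if $a\in\mathcal{A}^{-1}\setminus\mathcal{A}$, and $\theta(a)=0$ if $a\in\mathcal{A}\cap\mathcal{A}^{-1}$. Define $K\in\mathbb{C}^{V\times\mathcal{A}^{\pm}}$ by $K_{x,a}=\frac{1}{\sqrt{\deg_G x}}\delta_{x,t(a)}$, $C=2K^*K-I$, $(S_\theta)_{a,b}=e^{\theta(b)i}\delta_{a,b^{-1}}$ for $a,b\in\mathcal{A}^{\pm}$, and the time evolution matrix $U_\theta=S_\theta C\in\mathbb{C}^{\mathcal{A}^{\pm}\times\mathcal{A}^{\pm}}$. The mixed graph $G$ (equipped with $\theta$) is periodic if there is a positive integer $\tau$ with $U_\theta^{\tau}=I$.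
   Formalization: Bil, Her and Sym of 1×1 matrices with q = 2 or 3 are excluded: these graphs are K_2 and K_3, for which the claim fails (every mixed K_2 is periodic; K_3 with all arcs bidirected is periodic for every η). The sizes d, e, n are taken positive. *)

(* Defs.v *)
From HB Require Import structures.
From mathcomp Require Import all_boot all_order all_algebra.
From mathcomp Require Import reals trigo.
From mathcomp Require Import complex.
Set Implicit Arguments.
Unset Strict Implicit.
Unset Printing Implicit Defensive.
Import Order.TTheory GRing.Theory Num.Theory.
Local Open Scope ring_scope.
Local Open Scope complex_scope.

(* An arc x -> y is the pair (x, y): its origin is the first component, its
   terminus the second one. *)
Record mixedGraph (V : finType) := MixedGraph {
  arcs : {set V * V};
  arcs_loopless : forall x : V, (x, x) \notin arcs }.

Section MixedGraph.
Variables (V : finType) (G : mixedGraph V).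

Definition rev_arc (a : V * V) : V * V := (a.2, a.1).

Definition rev_arcs : {set V * V} := [set rev_arc a | a in arcs G].

Definition sym_arcs : {set V * V} := arcs G :|: rev_arcs.

Definition underlying : rel V := fun x y => (x, y) \in sym_arcs.

Definition mg_deg (x : V) : nat := #|[set y | underlying x y]|.

(* The undirected graph Gamma is given by its vertex type and adjacency. *)
Definition is_mixed (W : finType) (Gamma : rel W) : Prop :=
  exists f : V -> W,
    bijective f /\ forall x y, underlying x y = Gamma (f x) (f y).

Section Walk.
Variables (R : realType) (eta : R).

(* Only the values on sym_arcs matter. *)
Definition eta_fun (a : V * V) : R :=
  if a \in arcs G :\: rev_arcs then eta
  else if a \in rev_arcs :\: arcs G then - eta
  else 0.

Definition expi (t : R) : R[i] := cos t +i* sin t.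

(* Rows and columns are numbered by the enumerations of V and of sym_arcs. *)
Definition walk_K : 'M[R[i]]_(#|V|, #|sym_arcs|) :=
  \matrix_(i, j) (let x := enum_val i in let a := enum_val j in
    ((Num.sqrt (mg_deg x)%:R)^-1)%:C * (x == a.2)%:R).

Definition walk_Kstar : 'M[R[i]]_(#|sym_arcs|, #|V|) :=
  map_mx Num.conj walk_K^T.

Definition walk_C : 'M[R[i]]_#|sym_arcs| := 2 *: (walk_Kstar *m walk_K) - 1%:M.

Definition walk_S : 'M[R[i]]_#|sym_arcs| :=
  \matrix_(i, j) (let a := enum_val i in let b := enum_val j in
    expi (eta_fun b) * (a == rev_arc b)%:R).

Definition walk_U : 'M[R[i]]_#|sym_arcs| := walk_S *m walk_C.

Definition walk_periodic : Prop :=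
  exists tau : nat, (0 < tau)%N /\ walk_U ^+ tau = 1%:M.

End Walk.
End MixedGraph.

Definition prime_power (q : nat) : Prop :=
  exists p k : nat, [/\ prime p, (0 < k)%N & q = (p ^ k)%N].

Section SesquilinearForms.
Variable F : finFieldType.

Definition bil_adj (d e : nat) : rel 'M[F]_(d, e) :=
  fun M N => \rank (M - N) == 1%N.

Definition alt_mx (n : nat) (M : 'M[F]_n) : bool :=
  (M^T == - M) && [forall i, M i i == 0].

Definition alt_adj (n : nat) : rel {M : 'M[F]_n | alt_mx M} :=
  fun M N => \rank (val M - val N) == 2.

(* To be used with #|F| = q ^ 2. *)
Definition her_mx (q n : nat) (M : 'M[F]_n) : bool :=
  map_mx (fun x : F => x ^+ q) M^T == M.

Definition her_adj (q n : nat) : rel {M : 'M[F]_n | her_mx q M} :=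
  fun M N => \rank (val M - val N) == 1%N.

Definition sym_mx (n : nat) (M : 'M[F]_n) : bool := M^T == M.

Definition sym_adj (n : nat) : rel {M : 'M[F]_n | sym_mx M} :=
  fun M N => \rank (val M - val N) == 1%N.

End SesquilinearForms.

(* Main.v *)
Require Import Defs.
From mathcomp Require Import all_boot all_order all_algebra.
From mathcomp Require Import all_fingroup all_solvable all_field.
From mathcomp Require Import reals trigo complex.
From mathcomp Require Import ring zify.

(** Let G be a mixed graph of constant degree k on N vertices, and suppose that
    U = walk_U G eta has finite order.  Then U is diagonalizable and its
    eigenvalues are roots of unity, so their second elementary symmetric
    function e_2 is an algebraic integer.  On the other hand e_2 can be read
    off from two traces: (tr U)^2 = tr (U^2) + 2 e_2.  The trace of U vanishes
    because there are no loops, and in tr (U^2) each arc only meets its own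
    inverse, where the two phases cancel; hence

      tr (U^2) = k N (2 / k - 1)^2 = 4 N / k - 4 N + k N,

    whatever eta and the orientation are.  As k N is the number of arcs, which
    is even, 2 N / k is an algebraic integer, and being rational it is an
    integer: k divides 2 N ([walk_periodic_dvdn]).

    The vertices of a sesquilinear forms graph over a field of characteristic p
    form an additive group of matrices, so N is a power of p.  The valency k is
    prime to p: there are k + 1 forms of rank at most the given bound, and p
    divides k + 1 because transvections, each chosen according to entries of
    the form that it does not change, together with a translation of the forms
    where these entries vanish, make up a permutation of order p without fixed
    points ([dvdn_card_transvection]).
    Hence k divides 2, whereas 0 visibly has more than two neighbours.

    Symmetric forms are treated as Hermitian forms for the trivial
    involution. *)

Set Implicit Arguments.
Unset Strict Implicit.
Unset Printing Implicit Defensive.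
Import Order.TTheory GRing.Theory Num.Theory.
Local Open Scope ring_scope.

(** * Permutations of prime order *)

(** All orbits of [f] on [S] have exactly [p] elements. *)
Lemma prime_dvd_card_free (T : finType) (p : nat) (S : {set T}) (f : T -> T) :
  prime p -> {in S, forall x, f x \in S} -> {in S, forall x, iter p f x = x} ->
  {in S, forall x, f x != x} -> (p %| #|S|)%N.
Proof.
move=> p_pr fS fp fN.
pose g (u : {x | x \in S}) : {x | x \in S} := exist _ (f (val u)) (fS _ (valP u)).
have val_g n u : val (iter n g u) = iter n f (val u) by elim: n => //= n ->.
have gp u : iter p g u = u by apply: val_inj; rewrite val_g fp ?(valP u).
have g_inj : injective g.
  by move=> u v guv; rewrite -(gp u) -(gp v) -(prednK (prime_gt0 p_pr)) !iterSr guv.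
pose s := perm g_inj.
have sp : (s ^+ p = 1)%g.
  apply/permP => u; rewrite permX perm1 -[RHS]gp.
  by apply: eq_iter => w; rewrite permE.
have pG : (p.-group <[s]>)%g.
  by apply: (pnat_dvd _ (pnat_id p_pr)); rewrite order_dvdn sp.
have actT : [acts <[s]>%g, on [set: {x | x \in S}] | 'P].
  by apply/subsetP => a _; rewrite !inE; apply/subsetP => x; rewrite !inE.
have -> : #|S| = #|[set: {x | x \in S}]| by rewrite cardsT card_sig; apply: eq_card.
rewrite /dvdn (pgroup_fix_mod pG actT); apply/eqP; rewrite (_ : _ :&: _ = set0) ?cards0 ?mod0n //.
apply/setP => u; rewrite in_setI in_setT in_set0; apply/negP => /afixP fix_s.
have := fix_s s (cycle_id s).
rewrite /= apermE permE => /(congr1 val) /= fu.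
by have := fN _ (valP u); rewrite fu eqxx.
Qed.

(** * Traces of matrices of finite order *)

(** A rational algebraic integer is an integer; since integrality of a rational
    number does not depend on the ambient field, the fact is transported from
    the algebraic numbers to [K]. *)
Lemma dvdn_of_integral_quotient (K : numFieldType) (m k : nat) :
  (0 < k)%N -> integralOver (intr : int -> K) (m%:R / k%:R) -> (k %| m)%N.
Proof.
move=> k_gt0 [p p_mon].
pose r : rat := m%:R / k%:R.
have rE (L : numFieldType) : ratr r = m%:R / k%:R :> L.
  by rewrite fmorph_div !rmorph_nat.
have pE (L : numFieldType) :
    map_poly intr p = map_poly ratr (map_poly intr p : {poly rat}) :> {poly L}.
  by rewrite -map_poly_comp; apply: eq_map_poly => z /=; rewrite ratr_int.
rewrite -(rE K) pE fmorph_root => pr.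
have : (ratr r : algC) \in Aint.
  apply: (@root_monic_Aint (map_poly intr p)).
  - by rewrite pE fmorph_root.
  - by rewrite monic_map //; apply: intr_inj.
  - by apply/polyOverP => i; rewrite coef_map /= intr_int.
move/(Cint_rat_Aint (Crat_rat r)) => /intrP[z]; rewrite rE => /(canRL (divfK _)).
rewrite pnatr_eq0 -lt0n k_gt0 => /(_ isT) mE.
have : m%:Z = z * k%:Z by apply: (@intr_inj algC); rewrite rmorphM -!pmulrn mE.
by move/(congr1 absz); rewrite abszM !absz_nat => ->; rewrite dvdn_mull.
Qed.

(** Here [e] is the second elementary symmetric function of [s]. *)
Lemma square_sum_integral (K : fieldType) (s : seq K) :
  {in s, forall x, integralOver (intr : int -> K) x} ->
  exists2 e, integralOver (intr : int -> K) e &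
    (\sum_(x <- s) x) ^+ 2 = \sum_(x <- s) x ^+ 2 + e *+ 2.
Proof.
elim: s => [_|x s IHs xs_int].
  by exists 0; [exact: integral0|rewrite !big_nil expr0n mul0rn addr0].
have s_int : {in s, forall y, integralOver (intr : int -> K) y}.
  by move=> y ys; apply: xs_int; rewrite inE ys orbT.
have [e e_int sE] := IHs s_int.
have sum_int : integralOver (intr : int -> K) (\sum_(y <- s) y).
  rewrite big_seq; elim/big_ind: _ => //; [exact: integral0|].
  by move=> ? ?; apply: integral_add.
exists (x * (\sum_(y <- s) y) + e).
  by apply: integral_add => //; apply: integral_mul => //; apply: xs_int; rewrite mem_head.
by rewrite !big_cons sqrrD sE; ring.
Qed.

(** The minimal polynomial of [U] divides 'X^t - 1, which is separable in
    characteristic zero. *)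
Lemma finite_order_diagonal (K : numClosedFieldType) n (U : 'M[K]_n) (t : nat) :
  (0 < t)%N -> U ^+ t = 1%:M ->
  exists P (d : 'rV[K]_n), [/\ P \in unitmx, U = invmx P *m diag_mx d *m P &
    forall i, d 0 i ^+ t = 1].
Proof.
case: n U => [|n] U t_gt0 Ut.
  exists 1%:M, 0; split; [exact: unitmx1|by apply/matrixP => -[]|by case].
have [P Pu] : diagonalizable U.
  apply/diagonalizableP.
  have [rs] := closed_field_poly_normal ('X^t - 1 : {poly K}).
  rewrite lead_coefDl ?size_polyXn ?size_polyN ?size_poly1 ?ltnS // lead_coefXn scale1r.
  move=> rsE; exists rs.
    rewrite -separable_prod_XsubC -rsE; apply: separable_Xn_sub_1.
    by rewrite pnatr_eq0 -lt0n.
  rewrite -rsE; apply/mxminpoly_minP.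
  by rewrite rmorphB rmorphXn /= horner_mx_X rmorph1 Ut subrr.
case/diagonalizable_forPex => d /(simmxLR Pu); rewrite mxpoly.conjVmx // => UE.
exists P, d; split => // i.
have : diag_mx d ^+ t = 1%:M.
  have -> : diag_mx d = P *m U *m invmx P.
    by rewrite UE !mulmxA mulmxV // mul1mx mulmxK.
  have -> : (P *m U *m invmx P) ^+ t = P *m U ^+ t *m invmx P.
    elim: (t) => [|j IHj]; first by rewrite !expr0 mulmx1 mulmxV.
    by rewrite exprS IHj [U ^+ j.+1]exprS -!mulmxE !mulmxA mulmxKV.
  by rewrite Ut mulmx1 mulmxV.
move/matrixP/(_ i i); rewrite [1%:M i i]mxE eqxx mulr1n => <-.
elim: (t) => [|j IHj]; first by rewrite !expr0 mxE eqxx.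
rewrite exprS IHj [in RHS]exprS -mulmxE mul_diag_mx mxE //.
Qed.

(** The number [e] is the second elementary symmetric function of the
    eigenvalues of [U], which are roots of unity. *)
Lemma finite_order_trace (K : numClosedFieldType) n (U : 'M[K]_n) (t : nat) :
  (0 < t)%N -> U ^+ t = 1%:M ->
  exists2 e, integralOver (intr : int -> K) e &
    (\tr U) ^+ 2 = \tr (U *m U) + e *+ 2.
Proof.
move=> t_gt0 /(finite_order_diagonal t_gt0)[P [d [Pu UE dt]]].
have [|e e_int dE] := @square_sum_integral K [seq d 0 i | i : 'I_n].
  move=> _ /mapP[i _ ->]; exists ('X^t - 1); first by rewrite monicXnsubC.
  by rewrite rmorphB /= map_polyXn rmorph1 rootE !hornerE dt subrr.
exists e => //; move: dE; rewrite !big_image /=.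
have -> : \tr U = \sum_i d 0 i.
  by rewrite UE mxtrace_mulC mulmxA mulmxV // mul1mx mxtrace_diag.
have -> // : \tr (U *m U) = \sum_i d 0 i ^+ 2.
rewrite UE !mulmxA mulmxK // mxtrace_mulC !mulmxA mulmxV // mul1mx.
by apply: eq_bigr => i _; rewrite mul_diag_mx !mxE eqxx mulr1n expr2.
Qed.

(** * The traces of the time evolution matrix *)

Section Arcs.
Variables (V : finType) (G : mixedGraph V).

Lemma rev_arcK : involutive (@rev_arc V).
Proof. by case. Qed.

Lemma mem_rev_arcs a : (a \in rev_arcs G) = (rev_arc a \in arcs G).
Proof. by rewrite -[a in LHS]rev_arcK (mem_imset _ _ (inv_inj rev_arcK)). Qed.

Lemma mem_sym_arcs_rev a : (rev_arc a \in sym_arcs G) = (a \in sym_arcs G).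
Proof. by rewrite !inE !mem_rev_arcs rev_arcK orbC. Qed.

Lemma sym_arcs_loopless x : (x, x) \notin sym_arcs G.
Proof. by rewrite !inE mem_rev_arcs /rev_arc /= (negbTE (arcs_loopless G x)). Qed.

(** Reversal pairs off the arcs, as there are no loops. *)
Lemma sym_arcs_even : (2 %| #|sym_arcs G|)%N.
Proof.
apply: (@prime_dvd_card_free _ 2 _ (@rev_arc V)) => // [a|a _|[x y]].
- by rewrite mem_sym_arcs_rev.
- exact: rev_arcK.
- apply: contraTneq => -[_ ->]; exact: sym_arcs_loopless.
Qed.

Lemma card_sym_arcs k : (forall x, mg_deg G x = k) ->
  #|sym_arcs G| = (#|V| * k)%N.
Proof.
move=> degG; rewrite -sum1_card (eq_bigl (fun a => true && underlying G a.1 a.2)); last by case.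
rewrite -(pair_big_dep xpredT (underlying G) (fun _ _ => 1%N)) /=.
rewrite (eq_bigr (fun=> k)) ?sum_nat_const // => x _.
by rewrite -(degG x) /mg_deg -sum1_card; apply: eq_bigl => y; rewrite inE.
Qed.

Section Walk.
Variables (R : realType) (eta : R).

Lemma eta_fun_rev a : eta_fun G eta (rev_arc a) = - eta_fun G eta a.
Proof.
rewrite /eta_fun !inE !mem_rev_arcs rev_arcK.
by case: (a \in arcs G); case: (rev_arc a \in arcs G) => //=; rewrite ?opprK ?oppr0.
Qed.

Lemma expiNK (t : R) : expi t * expi (- t) = 1.
Proof.
rewrite /expi cosN sinN; apply/eqP; rewrite eq_complex /=; apply/andP; split; apply/eqP.
  by rewrite -(cos2Dsin2 t); ring.
ring.
Qed.

Variable k : nat.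
Hypothesis degG : forall x, mg_deg G x = k.
Hypothesis k_gt0 : (0 < k)%N.

Lemma walk_CE i j (a := enum_val i) (b := enum_val j) :
  walk_C G R i j = 2 / k%:R * (a.2 == b.2)%:R - (a == b)%:R.
Proof.
rewrite /walk_C mxE [X in X + _]mxE [X in _ + X]mxE [1%:M _ _]mxE (inj_eq enum_val_inj).
congr (_ - _); rewrite -mulrA; congr (_ * _); rewrite mxE.
rewrite (bigD1 (enum_rank a.2)) //= big1 ?addr0 => [|l l_neq]; last first.
  rewrite [walk_Kstar _ _ _ _]mxE [_^T _ _]mxE [walk_K _ _ _ _]mxE /=.
  case: eqP => [al|_]; last by rewrite mulr0 rmorph0 mul0r.
  by case/eqP: l_neq; rewrite -al enum_valK.
rewrite [walk_Kstar _ _ _ _]mxE [_^T _ _]mxE !mxE /= enum_rankK eqxx mulr1 degG.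
rewrite [Num.conj _]conjc_real mulrA -rmorphM -invfM -expr2 sqr_sqrtr ?ler0n //.
by rewrite fmorphV rmorph_nat.
Qed.

(** Row [a] of the shift has its only nonzero entry in column [rev_arc a]. *)
Lemma walk_UE i j (a := enum_val i) (b := enum_val j) :
  walk_U G eta i j = expi (eta_fun G eta (rev_arc a)) *
    (2 / k%:R * (a.1 == b.2)%:R - (b == rev_arc a)%:R).
Proof.
have ar : rev_arc a \in sym_arcs G by rewrite mem_sym_arcs_rev enum_valP.
rewrite !mxE (bigD1 (enum_rank_in ar (rev_arc a))) //= big1 ?addr0; last first.
  move=> l l_neq; rewrite [walk_S _ _ _ _]mxE /=.
  case: eqP => [al|_]; last by rewrite mulr0 mul0r.
  case/eqP: l_neq; apply: enum_val_inj; rewrite enum_rankK_in //.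
  by rewrite /a al rev_arcK.
rewrite [walk_S _ _ _ _]mxE /= enum_rankK_in // rev_arcK eqxx mulr1; congr (_ * _).
by rewrite walk_CE enum_rankK_in // -/b [rev_arc a == b]eq_sym.
Qed.

Lemma mxtrace_walk_U : \tr (walk_U G eta) = 0.
Proof.
apply: big1 => i _; rewrite walk_UE.
have := enum_valP i; case: (enum_val i) => x y /= xy.
have y_neq : x != y by apply: contraTneq xy => ->; apply: sym_arcs_loopless.
by rewrite /rev_arc xpair_eqE /= (negbTE y_neq) mulr0 subr0 mulr0.
Qed.

(** If b differs from the reverse of a, then the entries (a, b) and (b, a) of U
    are not both nonzero: a starts where b ends and b starts where a ends only
    when b reverses a.  For b the reverse of a, the two phases are inverse to
    each other. *)
Lemma mxtrace_walk_U2 :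
  \tr (walk_U G eta *m walk_U G eta) = #|sym_arcs G|%:R * (2 / k%:R - 1) ^+ 2.
Proof.
rewrite mulr_natl -[in RHS](card_ord #|sym_arcs G|) -sumr_const.
apply: eq_bigr => i _; rewrite mxE.
set a := enum_val i.
have ar : rev_arc a \in sym_arcs G by rewrite mem_sym_arcs_rev enum_valP.
rewrite (bigD1 (enum_rank_in ar (rev_arc a))) //= big1 ?addr0 => [|j j_neq]; last first.
  have b_neq : enum_val j != rev_arc a.
    apply: contraNneq j_neq => bE; apply/eqP/enum_val_inj; rewrite enum_rankK_in //.
  rewrite !walk_UE -/a (negbTE b_neq) -[a == _](can_eq rev_arcK) rev_arcK.
  rewrite [rev_arc a == _]eq_sym (negbTE b_neq) !subr0 mulrACA.
  case: (a.1 =P (enum_val j).2) => [e1|_]; last by rewrite !mulr0 mul0r mulr0.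
  case: ((enum_val j).1 =P a.2) => [e2|_]; last by rewrite !mulr0.
  case/eqP: b_neq; rewrite /rev_arc e1 -e2; by case: (enum_val j).
rewrite !walk_UE -/a enum_rankK_in // rev_arcK !eqxx mulrACA eta_fun_rev.
by rewrite [expi _ * _]mulrC expiNK mul1r !mulr1 expr2.
Qed.

(** Twice the second elementary symmetric function of the eigenvalues is
    -tr (U^2), so 2 |V| / k differs from an algebraic integer by an ordinary
    integer: here it matters that the number of arcs is even. *)
Lemma walk_periodic_dvdn : walk_periodic G eta -> (k %| 2 * #|V|)%N.
Proof.
case=> t [t_gt0 /(finite_order_trace t_gt0)[e e_int]].
rewrite mxtrace_walk_U mxtrace_walk_U2 (card_sym_arcs degG).
have /dvdnP[m mE] : (2 %| #|V| * k)%N by rewrite -(card_sym_arcs degG) sym_arcs_even.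
have k_neq0 : k%:R != 0 :> R[i] by rewrite pnatr_eq0 -lt0n.
rewrite natrM expr0n /= => eE.
have {}eE : (2 * #|V|)%:R / k%:R = (2 * #|V|)%:R - m%:R - e.
  apply: (@mulIf _ 2); first by rewrite pnatr_eq0.
  have mE' : #|V|%:R * k%:R = m%:R * 2 :> R[i] by rewrite -!natrM mE.
  rewrite natrM !mulrBl -mE'.
  have -> : e * 2 = - (#|V|%:R * k%:R * (2 / k%:R - 1) ^+ 2).
    by move/esym/eqP: eE; rewrite addrC addr_eq0 -[e *+ 2]mulr_natr => /eqP.
  by field.
apply: (@dvdn_of_integral_quotient R[i] _ _ k_gt0); rewrite eE.
by apply: integral_sub => //; apply: integral_sub; apply: integral_nat.
Qed.

End Walk.
End Arcs.

(** * Valencies modulo the characteristic *)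

(** Since [D] squares to zero, the k-th power of 1 + D is 1 + k D. *)
Lemma unipotent_pchar (F : fieldType) (p n : nat) (D : 'M[F]_n) :
  p \in [pchar F] -> D *m D = 0 -> (1%:M + D) ^+ p = 1%:M.
Proof.
move=> pF DD.
have -> : (1%:M + D) ^+ p = 1%:M + D *+ p.
  elim: p {pF} => [|k IHk]; first by rewrite expr0 mulr0n addr0.
  rewrite exprS IHk -mulmxE mulmxDl mul1mx mulmxDr mulmx1 -scaler_nat -scalemxAr DD.
  by rewrite scaler0 addr0 -addrA [_ + D]addrC scaler_nat -mulrS.
by rewrite -scaler_nat (pcharf0 pF) scale0r addr0.
Qed.

(** A nonzero entry (i, j) of M with i != 0 and j in J is not changed when row i
    is added to row 0, provided that the column operation [Q i] leaves the
    columns in J alone; but the entry (0, j) does change.  So M can choose its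
    transvection through the position of such an entry, and all its images
    make the same choice: iterating the choice p times amounts to iterating a
    single unipotent map, which gives the identity.  The matrices without such
    an entry are translated by E instead.  Taking [Q i] to be the identity
    gives row operations; taking it to be the transposed transvection gives
    congruences. *)
Lemma dvdn_card_transvection (F : finFieldType) (p m n : nat)
    (S : {set 'M[F]_(m.+1, n.+1)}) (J : pred 'I_n.+1)
    (Q : 'I_m.+1 -> 'M[F]_n.+1) (E : 'M[F]_(m.+1, n.+1)) :
    p \in [pchar F] ->
    (forall i, i != 0 -> Q i ^+ p = 1%:M) ->
    (forall i (A : 'M_(m.+1, n.+1)) a j, i != 0 -> J j -> (A *m Q i) a j = A a j) ->
    (forall i M, i != 0 -> M \in S -> (1%:M + delta_mx 0 i) *m M *m Q i \in S) ->
    E != 0 -> (forall i j, i != 0 -> J j -> E i j = 0) ->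
    (forall M, M \in S -> (forall i j, i != 0 -> J j -> M i j = 0) -> M + E \in S) ->
  (p %| #|S|)%N.
Proof.
move=> pF Qp QJ TS E_neq0 E0 ES.
pose pivot (M : 'M[F]_(m.+1, n.+1)) :=
  [pick u : 'I_m.+1 * 'I_n.+1 | [&& u.1 != 0, J u.2 & M u.1 u.2 != 0]].
pose g (o : option ('I_m.+1 * 'I_n.+1)) (M : 'M[F]_(m.+1, n.+1)) :=
  if o is Some u then (1%:M + delta_mx 0 u.1) *m M *m Q u.1 else M + E.
(* Multiplication by the transvection adds row i to row 0. *)
have TE (i : 'I_m.+1) (M : 'M[F]_(m.+1, n.+1)) (a : 'I_m.+1) j :
    ((1%:M + delta_mx 0 i) *m M) a j = M a j + M i j *+ (a == 0).
  rewrite mulmxDl mul1mx mxE; congr (_ + _); rewrite mxE (bigD1 i) //= big1 => [|l l_neq].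
    by rewrite mxE eqxx andbT mulr_natl addr0.
  by rewrite mxE (negbTE l_neq) andbF mul0r.
have gB o M M' a j : pivot M' = o -> a != 0 -> J j -> g o M a j = M a j.
  rewrite /pivot => <- a_neq0 Jj; case: pickP => [[i l] /= /and3P[i_neq0 Jl _]|_] /=.
    by rewrite QJ // TE (negbTE a_neq0) addr0.
  by rewrite mxE E0 // addr0.
have pivot_g o M M' : pivot M' = o -> pivot (g o M) = pivot M.
  move=> oE; apply: eq_pick => -[a j] /=.
  by case: eqP => // /eqP a_neq0; case: (boolP (J j)) => //= Jj; rewrite (gB _ _ _ _ _ oE).
have iter_f k M : iter k (fun N => g (pivot N) N) M = iter k (g (pivot M)) M.
  elim: k => //= k ->; congr (g _ _).
  by elim: k => //= k IHk; rewrite (pivot_g _ _ _ (erefl _)).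
apply: (@prime_dvd_card_free _ p S (fun N => g (pivot N) N)) => [|M MS|M MS|M MS].
- exact: pcharf_prime pF.
- rewrite /pivot /=; case: pickP => [[i l] /= /and3P[i_neq0 Jl _]|M0] /=.
    exact: TS.
  apply: ES => // i j i_neq0 Jj; have := M0 (i, j); rewrite /= i_neq0 Jj /=.
  by move/negbT; rewrite negbK => /eqP.
- rewrite iter_f /pivot; case: pickP => [[i l] /= /and3P[i_neq0 Jl _]|M0] /=.
    have -> k : iter k (g (Some (i, l))) M = (1%:M + delta_mx 0 i) ^+ k *m M *m Q i ^+ k.
      elim: k => [|k /= ->]; first by rewrite !expr0 mul1mx mulmx1.
      by rewrite exprS exprSr -!mulmxE !mulmxA.
    rewrite Qp // unipotent_pchar ?mul1mx ?mulmx1 //.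
    by rewrite mul_delta_mx_cond (negbTE i_neq0).
  have -> k : iter k (g None) M = M + E *+ k.
    by elim: k => [|k /= ->]; rewrite ?mulr0n ?addr0 // -addrA -mulrSr.
  by rewrite -scaler_nat (pcharf0 pF) scale0r addr0.
- rewrite /pivot; case: pickP => [[i l] /= /and3P[i_neq0 Jl M_neq0]|_] /=.
    apply: contraNneq M_neq0 => /matrixP/(_ 0 l); rewrite QJ // TE eqxx mulr1n.
    by move/(canRL (addKr _)); rewrite addNr => ->.
  by apply: contraNneq E_neq0 => /(canRL (addKr _)); rewrite addNr => ->.
Qed.

Lemma rank_outer (F : fieldType) m n (u : 'cV[F]_m) (v : 'rV[F]_n) :
  (\rank (u *m v) <= 1)%N.
Proof. exact: leq_trans (mxrankM_maxl u v) (rank_leq_col u). Qed.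

(** The 2 x 2 minors of a matrix of rank at most 1 vanish. *)
Lemma rank_le1_minor (F : fieldType) m n (M : 'M[F]_(m, n)) i j k l :
  (\rank M <= 1)%N -> M i j * M k l = M i l * M k j.
Proof.
rewrite -{2 3 4 5}(mulmx_base M); move: (col_base M) (row_base M).
case: (\rank M) => [|[|r]] // A B _; rewrite !mxE ?big_ord0 ?mul0r ?big_ord1 //.
by ring.
Qed.

Lemma rank_row0 (F : fieldType) m n (M : 'M[F]_(m.+1, n)) :
  (forall i j, i != 0 -> M i j = 0) -> (\rank M <= 1)%N.
Proof.
move=> M0; rewrite (_ : M = delta_mx 0 0 *m row 0 M) ?rank_outer //.
apply/matrixP => i j; rewrite mxE big_ord1 !mxE eqxx andbT.
by case: eqP => [->|/eqP i_neq0]; rewrite ?mul1r // mul0r M0.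
Qed.

(** The zero matrix is the only element of [P] of rank less than [r]. *)
Lemma card_rank_le (F : finFieldType) m n r (P : pred 'M[F]_(m, n)) :
  (0 < r)%N -> P 0 ->
  (forall M, P M -> M != 0 -> (\rank M <= r)%N = (\rank M == r)) ->
  #|[set M | P M && (\rank M <= r)%N]| = #|[set M | P M && (\rank M == r)]|.+1.
Proof.
move=> r_gt0 P0 Pr; rewrite (cardsD1 0) inE P0 mxrank0 add1n; congr _.+1.
apply: eq_card => M; rewrite !inE.
have [->|M_neq0] := eqVneq M 0; first by rewrite P0 mxrank0 eq_sym eqn0Ngt r_gt0.
by case: (boolP (P M)) => //= PM; rewrite Pr.
Qed.

Lemma rank_le1_eq1 (F : fieldType) m n (M : 'M[F]_(m, n)) :
  M != 0 -> (\rank M <= 1)%N = (\rank M == 1)%N.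
Proof. by rewrite -mxrank_eq0 -lt0n eqn_leq => ->; rewrite andbT. Qed.

Lemma dvdn_bil_valency (F : finFieldType) (p d e : nat) : p \in [pchar F] ->
  (0 < d)%N -> (0 < e)%N ->
  (p %| #|[set M : 'M[F]_(d, e) | \rank M == 1]|.+1)%N.
Proof.
case: d e => [|d] [|e] // pF _ _.
rewrite -(@card_rank_le _ _ _ _ xpredT) //= => [|M _]; last exact: rank_le1_eq1.
apply: (@dvdn_card_transvection _ p _ _ _ xpredT (fun=> 1%:M) (delta_mx 0 0)) => //.
- by move=> i _; rewrite expr1n.
- by move=> i A a j _ _; rewrite mulmx1.
- move=> i M _; rewrite !inE mulmx1; apply: leq_trans; exact: mxrankM_maxr.
- by apply/eqP => /matrixP/(_ 0 0)/eqP; rewrite !mxE oner_eq0.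
- by move=> i j /negbTE i0 _; rewrite mxE i0.
- move=> M _ M0; rewrite inE rank_row0 // => i j i_neq0.
  by rewrite !mxE (negbTE i_neq0) M0 // addr0.
Qed.

Definition herm_mx (F : fieldType) (s : F -> F) n (M : 'M[F]_n) :=
  map_mx s M^T == M.

(** The transvections act by congruence.  If a form of
    rank at most 1 vanishes outside row and column 0, its minor on rows and
    columns 0 and j shows that it is a multiple of the matrix unit at (0, 0). *)
Lemma dvdn_her_valency (F : finFieldType) (p n : nat) (s : {rmorphism F -> F}) :
  p \in [pchar F] -> involutive s -> (0 < n)%N ->
  (p %| #|[set M : 'M[F]_n | herm_mx s M && (\rank M == 1)]|.+1)%N.
Proof.
case: n => [|n] // pF sK _.
rewrite -card_rank_le // => [||M _]; last exact: rank_le1_eq1; last first.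
  by rewrite /herm_mx trmx0 map_mx0.
apply: (@dvdn_card_transvection _ p _ _ _ (fun j => j != 0)
  (fun i => 1%:M + delta_mx i 0) (delta_mx 0 0)) => //.
- move=> i i_neq0; apply: unipotent_pchar => //.
  by rewrite mul_delta_mx_cond eq_sym (negbTE i_neq0).
- move=> i A a j _ /negbTE j0; rewrite mulmxDr mulmx1 mxE [X in _ + X]mxE big1 ?addr0 // => l _.
  by rewrite mxE j0 andbF mulr0.
- move=> i M _; rewrite !inE => /andP[/eqP MH Mr]; apply/andP; split; last first.
    by apply: leq_trans Mr; apply: leq_trans (mxrankM_maxl _ _) (mxrankM_maxr _ _).
  have TH (a b : 'I_n.+1) :
      map_mx s (1%:M + delta_mx a b)^T = 1%:M + delta_mx b a :> 'M[F]_n.+1.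
    by rewrite linearD /= trmx1 trmx_delta map_mxD map_mx1 map_delta_mx.
  by apply/eqP; rewrite !trmx_mul !map_mxM MH !TH mulmxA.
- by apply/eqP => /matrixP/(_ 0 0)/eqP; rewrite !mxE oner_eq0.
- by move=> i j /negbTE i0 _; rewrite mxE i0.
- move=> M; rewrite !inE => /andP[/eqP MH Mr] M0.
  have Mj0 j : j != 0 -> M j 0 = 0.
    move=> j_neq0; have := rank_le1_minor 0 j j 0 Mr.
    rewrite (M0 j j) // mulr0 -{1}MH !mxE => /eqP.
    by rewrite mulf_eq0 fmorph_eq0 orbb => /eqP.
  apply/andP; split.
    by rewrite /herm_mx linearD /= map_mxD MH trmx_delta map_delta_mx.
  apply: rank_row0 => i j i_neq0; rewrite !mxE (negbTE i_neq0) addr0.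
  by have [->|] := eqVneq j 0; [exact: Mj0|exact: M0].
Qed.

(** This form of the alternating condition makes its invariance under congruence
    evident, also in characteristic 2; for [N] one takes the part of [M] above
    the diagonal. *)
Lemma alt_mxP (F : finFieldType) n (M : 'M[F]_n) :
  reflect (exists N, M = N - N^T) (alt_mx M).
Proof.
apply: (iffP andP) => [[/eqP MT /forallP M0]|[N ->]]; last first.
  by split; [rewrite linearB /= trmxK opprB|apply/forallP => i; rewrite !mxE subrr].
exists (\matrix_(i, j) if (i < j)%N then M i j else 0); apply/matrixP => i j; rewrite !mxE.
case: ltngtP => [ij|ij|/val_inj ->]; rewrite ?subr0 ?sub0r //; last exact/eqP.
by have := congr1 (fun A : 'M_n => A j i) MT; rewrite !mxE.
Qed.

(** The minor on rows and columns i and j is the square of the entry (i, j). *)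
Lemma alt_rank_gt1 (F : finFieldType) n (M : 'M[F]_n) :
  alt_mx M -> M != 0 -> (1 < \rank M)%N.
Proof.
case/andP => /eqP MT /forallP M0; apply: contraR; rewrite -leqNgt => Mr.
apply/eqP/matrixP => i j; rewrite mxE; apply/eqP.
have := rank_le1_minor i j j i Mr; rewrite (eqP (M0 i)) mul0r.
have -> : M j i = - M i j by have := congr1 (fun A : 'M_n => A i j) MT; rewrite !mxE.
by move/eqP; rewrite mulrN oppr_eq0 mulf_eq0 orbb.
Qed.

Lemma alt_rank_le2 (F : finFieldType) n (M : 'M[F]_n) : alt_mx M ->
  M != 0 -> (\rank M <= 2)%N = (\rank M == 2)%N.
Proof. by move=> Ma M_neq0; rewrite [RHS]eqn_leq alt_rank_gt1 // andbT. Qed.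

Lemma alt_mx0 (F : finFieldType) n : alt_mx (0 : 'M[F]_n).
Proof. by apply/alt_mxP; exists 0; rewrite trmx0 subr0. Qed.

Lemma rank_row0_col0 (F : fieldType) m n (M : 'M[F]_(m.+1, n.+1)) :
  (forall i j, i != 0 -> j != 0 -> M i j = 0) -> (\rank M <= 2)%N.
Proof.
move=> M0; pose N := M - delta_mx 0 0 *m row 0 M.
have -> : M = delta_mx 0 0 *m row 0 M + N by rewrite addrC subrK.
apply: leq_trans (mxrank_add _ _) _; apply: (@leq_add _ _ 1 1); first exact: rank_outer.
rewrite -mxrank_tr; apply: rank_row0 => j i j_neq0.
rewrite /N !mxE big_ord1 !mxE eqxx andbT; have [->|i_neq0] := eqVneq i 0.
  by rewrite mul1r subrr.
by rewrite mul0r subr0 M0.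
Qed.

(** As for Hermitian forms, except that an alternating form which vanishes
    outside row and column 0 always has rank at most 2 and may be translated
    along its row 0. *)
Lemma dvdn_alt_valency (F : finFieldType) (p n : nat) :
  p \in [pchar F] -> (1 < n)%N ->
  (p %| #|[set M : 'M[F]_n | alt_mx M && (\rank M == 2)]|.+1)%N.
Proof.
case: n => [|[|n]] // pF _.
rewrite -card_rank_le //; [|exact: alt_mx0|exact: alt_rank_le2].
pose one : 'I_n.+2 := lift 0 0.
apply: (@dvdn_card_transvection _ p _ _ _ (fun j => j != 0)
  (fun i => 1%:M + delta_mx i 0) (delta_mx 0 one - (delta_mx 0 one)^T)) => //.
- move=> i i_neq0; apply: unipotent_pchar => //.
  by rewrite mul_delta_mx_cond eq_sym (negbTE i_neq0).
- move=> i A a j _ /negbTE j0; rewrite mulmxDr mulmx1 mxE [X in _ + X]mxE big1 ?addr0 // => l _.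
  by rewrite mxE j0 andbF mulr0.
- move=> i M _; rewrite !inE => /andP[/alt_mxP[N ->] Mr]; apply/andP; split; last first.
    by apply: leq_trans Mr; apply: leq_trans (mxrankM_maxl _ _) (mxrankM_maxr _ _).
  have -> : 1%:M + delta_mx i 0 = (1%:M + delta_mx 0 i)^T :> 'M[F]_n.+2.
    by rewrite linearD /= trmx1 trmx_delta.
  set T := 1%:M + _; apply/alt_mxP; exists (T *m N *m T^T).
  by rewrite mulmxBr mulmxBl !trmx_mul trmxK mulmxA.
- by apply/eqP => /matrixP/(_ 0 one)/eqP; rewrite !mxE subr0 oner_eq0.
- by move=> i j /negbTE i0 /negbTE j0; rewrite !mxE i0 j0 subrr.
- move=> M; rewrite !inE => /andP[/alt_mxP[N ->] Mr] M0; apply/andP; split.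
    by apply/alt_mxP; exists (N + delta_mx 0 one); rewrite linearD /=; rewrite opprD addrACA.
  apply: rank_row0_col0 => i j i0 j0; rewrite mxE M0 // !mxE.
  by rewrite (negbTE i0) (negbTE j0) subrr addr0.
Qed.

(** * Lower bounds on valencies *)

(** This gives the lower bound for 1 x 1 matrices, where only the size of the
    field of scalars can help. *)
Lemma card_scalar_unit_le (F : finFieldType) m n (A : {set 'M[F]_(m.+1, n.+1)}) (c : {set F}) :
  {in c, forall x, x != 0 -> x *: delta_mx 0 0 \in A} -> (#|c| <= #|A|.+1)%N.
Proof.
move=> cA; apply: (@leq_trans (#|c :\ 0|.+1)).
  by rewrite (cardsD1 0 c); case: (0 \in c).
rewrite ltnS -(card_imset (c :\ 0) (f := fun x => x *: (delta_mx 0 0 : 'M[F]_(m.+1, n.+1)))).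
  by apply/subset_leq_card/subsetP => _ /imsetP[x /setD1P[x_neq0 xc] ->]; apply: cA.
by move=> x y /matrixP/(_ 0 0); rewrite !mxE !mulr1.
Qed.

Lemma rank_scalar_unit (F : fieldType) m n (x : F) :
  x != 0 -> \rank (x *: (delta_mx 0 0 : 'M[F]_(m.+1, n.+1))) == 1%N.
Proof. by move=> x_neq0; rewrite mxrank_scale_nz // mxrank_delta. Qed.

Lemma rank_outer_eq1 (F : fieldType) m n (u : 'cV[F]_m) (v : 'rV[F]_n) i j :
  (u *m v) i j != 0 -> \rank (u *m v) == 1%N.
Proof.
move=> uv_neq0; rewrite -rank_le1_eq1 ?rank_outer //.
by apply: contraNneq uv_neq0 => ->; rewrite mxE.
Qed.

Lemma outerE (F : fieldType) m n (u : 'cV[F]_m) (v : 'rV[F]_n) i j :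
  (u *m v) i j = u i 0 * v 0 j.
Proof. by rewrite mxE big_ord1. Qed.

Lemma matrix_neq (F : fieldType) m n (A B : 'M[F]_(m, n)) i j :
  A i j != B i j -> A != B.
Proof. by apply: contraNneq => ->. Qed.

Lemma bil_valency_gt2 (F : finFieldType) d e :
  (0 < d)%N -> (0 < e)%N -> (1 < d * e)%N || (3 < #|F|)%N ->
  (2 < #|[set M : 'M[F]_(d, e) | \rank M == 1]|)%N.
Proof.
case: d e => [|d] [|e] // _ _ /orP[de|F_gt3]; last first.
  rewrite -ltnS; apply: leq_trans F_gt3 _; rewrite -cardsT.
  by apply: card_scalar_unit_le => x _ x_neq0; rewrite inE rank_scalar_unit.
(* Two different matrix units in one row, and their sum. *)
have wide k l : (2 < #|[set M : 'M[F]_(k.+1, l.+2) | \rank M == 1]|)%N.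
  apply/card_gt2P; pose a : 'I_l.+2 := lift 0 0; pose u : 'cV[F]_k.+1 := delta_mx 0 0.
  exists (u *m delta_mx 0 0), (u *m delta_mx 0 a), (u *m (delta_mx 0 0 + delta_mx 0 a)).
  split; split; rewrite ?inE.
  - by apply: (@rank_outer_eq1 _ _ _ _ _ 0 0); rewrite outerE !mxE mulr1 oner_eq0.
  - by apply: (@rank_outer_eq1 _ _ _ _ _ 0 a); rewrite outerE !mxE mulr1 oner_eq0.
  - by apply: (@rank_outer_eq1 _ _ _ _ _ 0 a); rewrite outerE !mxE add0r mulr1 oner_eq0.
  - by apply: (@matrix_neq _ _ _ _ _ 0 0); rewrite !outerE !mxE mulr1 mulr0 oner_eq0.
  - by apply: (@matrix_neq _ _ _ _ _ 0 0); rewrite !outerE !mxE addr0 mulr1 mulr0 eq_sym oner_eq0.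
  - by apply: (@matrix_neq _ _ _ _ _ 0 a); rewrite !outerE !mxE add0r mulr1 mulr0 oner_eq0.
case: e de => [|e] de; last exact: wide.
case: d de => [|d] // _; apply: leq_trans (wide 0 d) _.
rewrite -(card_imset _ (can_inj (@trmxK F 1 d.+2))).
apply/subset_leq_card/subsetP => _ /imsetP[M + ->].
by rewrite !inE mxrank_tr.
Qed.

Lemma her_valency_gt2 (F : finFieldType) (n : nat) (s : {rmorphism F -> F}) :
  (0 < n)%N -> (1 < n)%N || (3 < #|[set x | s x == x]|)%N ->
  (2 < #|[set M : 'M[F]_n | herm_mx s M && (\rank M == 1)]|)%N.
Proof.
case: n => [|n] // _ /orP[|s_gt3]; last first.
  rewrite -ltnS; apply: leq_trans s_gt3 _.
  apply: card_scalar_unit_le => x; rewrite inE => /eqP sx x_neq0.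
  by rewrite inE rank_scalar_unit // /herm_mx linearZ /= trmx_delta map_mxZ sx map_delta_mx eqxx.
case: n => [|n] // _; apply/card_gt2P.
pose one : 'I_n.+2 := lift 0 0.
have outer_in (v : 'rV[F]_n.+2) i : map_mx s v = v -> v 0 i != 0 ->
    v^T *m v \in [set M : 'M[F]_n.+2 | herm_mx s M && (\rank M == 1)].
  move=> sv vi; rewrite inE (@rank_outer_eq1 _ _ _ _ _ i i) ?outerE ?mxE ?mulf_neq0 // andbT.
  by rewrite /herm_mx trmx_mul trmxK map_mxM -map_trmx sv.
have v2E (v : 'rV[F]_n.+2) i j : (v^T *m v) i j = v 0 i * v 0 j by rewrite outerE mxE.
pose x : 'rV[F]_n.+2 := delta_mx 0 0; pose y : 'rV[F]_n.+2 := delta_mx 0 one.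
(* The vectors have entries 0 and 1, which every automorphism fixes. *)
exists (x^T *m x), (y^T *m y), ((x + y)^T *m (x + y)).
split; split.
- by apply: (outer_in _ 0); rewrite ?map_delta_mx // !mxE oner_eq0.
- by apply: (outer_in _ one); rewrite ?map_delta_mx // !mxE oner_eq0.
- by apply: (outer_in _ 0); rewrite ?map_mxD ?map_delta_mx // !mxE addr0 oner_eq0.
- by apply: (@matrix_neq _ _ _ _ _ 0 0); rewrite !v2E !mxE mulr1 mulr0 oner_eq0.
- by apply: (@matrix_neq _ _ _ _ _ 0 0); rewrite !v2E !mxE addr0 mulr1 mulr0 eq_sym oner_eq0.
- by apply: (@matrix_neq _ _ _ _ _ one one); rewrite !v2E !mxE add0r mulr1 mulr0 oner_eq0.
Qed.

Lemma alt_valency_gt2 (F : finFieldType) (n : nat) : (2 < n)%N ->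
  (2 < #|[set M : 'M[F]_n | alt_mx M && (\rank M == 2)]|)%N.
Proof.
case: n => [|[|[|n]]] // _; apply/card_gt2P.
pose a : 'I_n.+3 := lift 0 0; pose b : 'I_n.+3 := lift 0 (lift 0 0).
pose A (v : 'rV[F]_n.+3) := delta_mx 0 0 *m v - (delta_mx 0 0 *m v)^T.
have AE (v : 'rV[F]_n.+3) (i : 'I_n.+3) : i != 0 -> A v 0 i = v 0 i.
  by move=> /negbTE i0; rewrite !mxE !big_ord1 !mxE i0 mul0r subr0 mul1r.
have A_in (v : 'rV[F]_n.+3) (i : 'I_n.+3) : i != 0 -> v 0 i != 0 ->
    A v \in [set M : 'M[F]_n.+3 | alt_mx M && (\rank M == 2)].
  move=> i0 v0; have A_alt : alt_mx (A v) by apply/alt_mxP; eexists.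
  rewrite inE A_alt -alt_rank_le2 //; last first.
    by apply: contraNneq v0 => /matrixP/(_ 0 i); rewrite AE // mxE => ->.
  apply: leq_trans (mxrank_add _ _) (@leq_add _ _ 1 1 _ _); first exact: rank_outer.
  by rewrite mxrank_opp mxrank_tr; exact: rank_outer.
exists (A (delta_mx 0 a)), (A (delta_mx 0 b)), (A (delta_mx 0 a + delta_mx 0 b)).
split; split.
- by apply: (A_in _ a); rewrite // !mxE oner_eq0.
- by apply: (A_in _ b); rewrite // !mxE oner_eq0.
- by apply: (A_in _ a); rewrite // !mxE addr0 oner_eq0.
- by apply: (@matrix_neq _ _ _ _ _ 0 a); rewrite !AE // !mxE oner_eq0.
- by apply: (@matrix_neq _ _ _ _ _ 0 a); rewrite !AE // !mxE addr0 eq_sym oner_eq0.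
- by apply: (@matrix_neq _ _ _ _ _ 0 b); rewrite !AE // !mxE add0r oner_eq0.
Qed.

(** The map x |-> x^(q+1) takes values in the fixed field and its fibres have at
    most q + 1 elements; three values would give q^2 <= 3 (q + 1). *)
Lemma card_fixed_frobenius (F : finFieldType) q :
  #|F| = (q ^ 2)%N -> (3 < q)%N -> (3 < #|[set x : F | x ^+ q == x]|)%N.
Proof.
move=> oF q_gt3; set S := [set _ | _]; rewrite ltnNge; apply/negP => S_le3.
have normS x : x ^+ q.+1 \in S.
  by rewrite inE -exprM mulSn mulnn -oF exprD expf_card -exprSr.
(* The fibre over c consists of roots of 'X^(q+1) - c. *)
have fibre c : (#|[set x : F | x ^+ q.+1 == c]| <= q.+1)%N.
  have := @max_poly_roots F ('X^(q.+1) - c%:P) (enum [set x : F | x ^+ q.+1 == c]).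
  rewrite -size_poly_eq0 size_XnsubC // enum_uniq -cardE ltnS; apply => //.
  by apply/allP => x; rewrite mem_enum inE rootE !hornerE subr_eq0.
have : (#|F| <= #|S| * q.+1)%N.
  rewrite -[leqLHS]sum1_card (partition_big (fun x => x ^+ q.+1) (mem S)) //=.
  rewrite -sum_nat_const; apply: leq_sum => c _; rewrite sum1_card.
  by apply: leq_trans (fibre c); apply: eq_leq; apply: eq_card => x; rewrite inE.
by rewrite oF; nia.
Qed.

(** * Rank graphs on additive groups of matrices *)

(** The forms are the values of [f], so that the vertices may be matrices or
    elements of a subtype of matrices. *)
Section RankGraph.
Variables (F : finFieldType) (m n r : nat) (P : pred 'M[F]_(m, n)).
Variables (W : finType) (f : W -> 'M[F]_(m, n)).
Hypothesis P0 : P 0.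
Hypothesis PB : forall M N, P M -> P N -> P (M - N).
Hypothesis f_inj : injective f.
Hypothesis fP : forall M, reflect (exists w, M = f w) (P M).

(** Translation by a vertex carries its neighbours to the forms of rank [r]. *)
Lemma rank_graph_degree w :
  #|[set w' | \rank (f w - f w') == r]| = #|[set M | P M && (\rank M == r)]|.
Proof.
have Pf u : P (f u) by apply/fP; exists u.
have g_inj : injective (fun w' => f w - f w').
  by move=> u v /addrI/oppr_inj/f_inj.
rewrite -(card_imset _ g_inj); apply: eq_card => M; rewrite inE; apply/imsetP/andP.
  by case=> w'; rewrite inE => rw ->; split=> //; apply: PB.
case=> PM rM; have /fP[w' w'E] : P (f w - M) by apply: PB.
by exists w'; rewrite ?inE -w'E subKr.
Qed.

(** The forms are a subgroup of the additive group of all matrices. *)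
Lemma card_rank_graph_dvdn : (#|W| %| #|F| ^ (m * n))%N.
Proof.
have PN M : P M -> P (- M) by move=> PM; rewrite -sub0r PB.
have PD M N : P M -> P N -> P (M + N) by move=> PM PN'; rewrite -[N]opprK PB // PN.
have gP : group_set [set M | P M].
  by apply/group_setP; split=> [|M N]; rewrite !inE; [exact: P0|exact: PD].
rewrite -card_mx -[#|{: 'M[F]_(m, n)}|]cardsT.
have -> : #|W| = #|Group gP|.
  rewrite -cardsT -(card_imset _ f_inj); apply: eq_card => M; rewrite [RHS]inE.
  by apply/imsetP/fP => -[w]; [exists w|move=> ->; exists w].
exact: (@cardSg _ [set: 'M[F]_(m, n)]%G (Group gP) (subsetT _)).
Qed.

(** The valency k divides 2 |V|, is prime to |V|, and exceeds 2. *)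
Lemma rank_graph_not_periodic (R : realType) (eta : R) (p : nat)
    (Gamma : rel W) (V : finType) (G : mixedGraph V) :
  (forall u v, Gamma u v = (\rank (f u - f v) == r)) ->
  prime p -> (exists j, #|F| = (p ^ j)%N) ->
  (p %| #|[set M | P M && (\rank M == r)]|.+1)%N ->
  (2 < #|[set M | P M && (\rank M == r)]|)%N ->
  is_mixed G Gamma -> ~ walk_periodic G eta.
Proof.
move=> GammaE p_pr [j Fj]; set k := #|[set M | P M && _]| => pk k_gt2 [h [h_bij hE]] perG.
have degG x : mg_deg G x = k.
  rewrite /k -(rank_graph_degree (h x)) /mg_deg -(card_imset _ (bij_inj h_bij)).
  apply: eq_card => w; rewrite inE; apply/imsetP/idP => [[y]|].
    by rewrite inE hE GammaE => hy ->.
  have [h' hK h'K] := h_bij.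
  by move=> rw; exists (h' w); rewrite ?inE ?hE ?GammaE h'K.
have k_gt0 : (0 < k)%N by apply: ltn_trans k_gt2.
have := walk_periodic_dvdn degG k_gt0 perG.
rewrite (bij_eq_card h_bij) Gauss_dvdl => [/dvdn_leq|].
  by move/(_ isT); rewrite leqNgt k_gt2.
apply: coprime_dvdr card_rank_graph_dvdn _; rewrite Fj -expnM coprimeXr //.
rewrite coprime_sym prime_coprime //; apply/negP => p_k.
by move: pk p_pr; rewrite -addn1 dvdn_addr // dvdn1 => /eqP->.
Qed.
End RankGraph.

(** * The sesquilinear forms graphs *)

Lemma sig_imageP (T : Type) (P : pred T) (M : T) :
  reflect (exists w : {x | P x}, M = val w) (P M).
Proof. by apply: (iffP idP) => [PM|[w ->]]; [exists (exist _ M PM)|exact: valP]. Qed.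

Lemma frobenius_power (F : fieldType) p j : p \in [pchar F] ->
  exists s : {rmorphism F -> F}, forall x, s x = x ^+ (p ^ j).
Proof.
move=> pF; elim: j => [|j [s sE]]; first by exists idfun.
exists (pFrobenius_aut pF \o s) => x /=.
by rewrite pFrobenius_autE sE -exprM expnSr.
Qed.

(** The predicate [Q] is a parameter because the subtype that carries the graph
    may express the Hermitian condition in another way. *)
Lemma herm_graph_not_periodic (R : realType) (eta : R) (p j : nat) (F : finFieldType)
    (n : nat) (s : {rmorphism F -> F}) (Q : pred 'M[F]_n) (Gamma : rel {M | Q M})
    (V : finType) (G : mixedGraph V) :
  prime p -> #|F| = (p ^ j)%N -> involutive s -> Q =1 @herm_mx F s n ->
  (forall M N, Gamma M N = (\rank (val M - val N) == 1%N)) ->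
  (0 < n)%N -> (1 < n)%N || (3 < #|[set x | s x == x]|)%N ->
  is_mixed G Gamma -> ~ walk_periodic G eta.
Proof.
move=> p_pr oF sK QE GammaE n_gt0 n_big.
have pF := card_finPcharP oF p_pr.
have setE : [set M : 'M[F]_n | Q M && (\rank M == 1)]
    = [set M | herm_mx s M && (\rank M == 1)].
  by apply/setP => M; rewrite !inE QE.
apply: (@rank_graph_not_periodic F n n 1 Q _ val _ _ val_inj _ _ _ p) => //.
- by rewrite QE /herm_mx trmx0 map_mx0.
- by move=> M N; rewrite !QE /herm_mx linearB /= map_mxB => /eqP-> /eqP->.
- exact: sig_imageP.
- by exists j.
- by rewrite setE; apply: dvdn_her_valency.
- by rewrite setE; apply: her_valency_gt2.
Qed.

(* The conditions (1 < d * e) || (3 < q) and (1 < n) || (3 < q) leave out only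
   the graphs of 1 x 1 matrices over the fields with 2 and 3 elements (in the
   Hermitian case, q = 2, 3): these graphs are K_2 and K_3, and for eta = 0
   the walks on them are periodic. *)
Theorem theorem8p1 (R : realType) (q : nat) (eta : R) :
  prime_power q -> 0 <= eta < 2 * pi ->
  [/\ (forall (F : finFieldType) (d e : nat) (V : finType) (G : mixedGraph V),
         #|F| = q -> (0 < d)%N -> (0 < e)%N -> (1 < d * e)%N || (3 < q)%N ->
         is_mixed G (@bil_adj F d e) -> ~ walk_periodic G eta),
      (forall (F : finFieldType) (n : nat) (V : finType) (G : mixedGraph V),
         #|F| = q -> (4 <= n)%N ->
         is_mixed G (@alt_adj F n) -> ~ walk_periodic G eta),
      (forall (F : finFieldType) (n : nat) (V : finType) (G : mixedGraph V),
         #|F| = (q ^ 2)%N -> (0 < n)%N -> (1 < n)%N || (3 < q)%N ->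
         is_mixed G (@her_adj F q n) -> ~ walk_periodic G eta) &
      (forall (F : finFieldType) (n : nat) (V : finType) (G : mixedGraph V),
         #|F| = q -> (0 < n)%N -> (1 < n)%N || (3 < q)%N ->
         is_mixed G (@sym_adj F n) -> ~ walk_periodic G eta)].
Proof.
move=> [p [j [p_pr j_gt0 qE]]] _; split=> F.
- move=> d e V G oF d_gt0 e_gt0 de_big.
  have Fp : #|F| = (p ^ j)%N by rewrite oF.
  have pF := card_finPcharP Fp p_pr.
  apply: (@rank_graph_not_periodic F d e 1 xpredT _ id _ _ _ _ _ _ p) => //.
  + by move=> M; apply: (iffP idP) => // _; exists M.
  + by exists j.
  + exact: dvdn_bil_valency.
  + by apply: bil_valency_gt2; rewrite ?oF.
- move=> n V G oF n_ge4.
  have Fp : #|F| = (p ^ j)%N by rewrite oF.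
  have pF := card_finPcharP Fp p_pr.
  apply: (@rank_graph_not_periodic F n n 2 (@alt_mx F n) _ val _ _ val_inj _ _ _ p) => //.
  + exact: alt_mx0.
  + move=> _ _ /alt_mxP[M ->] /alt_mxP[N ->]; apply/alt_mxP; exists (M - N).
    have -> : (M - N)^T = M^T - N^T by rewrite linearB.
    by rewrite !opprB -!addrA; congr (_ + _); rewrite addrA [- M^T + _]addrC addrC.
  + exact: sig_imageP.
  + by exists j.
  + by apply: dvdn_alt_valency => //; apply: leq_trans n_ge4.
  + by apply: alt_valency_gt2; apply: leq_trans n_ge4.
- move=> n V G oF n_gt0 n_big.
  have Fp : #|F| = (p ^ (j * 2))%N by rewrite oF qE expnM.
  have [s sE] := frobenius_power j (card_finPcharP Fp p_pr).
  apply: (@herm_graph_not_periodic _ _ _ _ _ _ s _ _ _ _ p_pr Fp) => //.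
  + by move=> x; rewrite !sE -qE -exprM mulnn -oF expf_card.
  + by move=> M; rewrite /her_mx /herm_mx; congr (_ == _); apply: eq_map_mx => x; rewrite sE qE.
  + case/orP: n_big => [->//|q_gt3]; apply/orP; right.
    rewrite (_ : [set _ | _] = [set x | x ^+ q == x]); first exact: card_fixed_frobenius.
    by apply/setP => x; rewrite !inE sE qE.
- move=> n V G oF n_gt0 n_big.
  have Fp : #|F| = (p ^ j)%N by rewrite oF.
  apply: (@herm_graph_not_periodic _ _ _ _ _ _ idfun _ _ _ _ p_pr Fp) => //.
  + by move=> M; rewrite /sym_mx /herm_mx map_mx_id.
  + case/orP: n_big => [->//|q_gt3]; apply/orP; right.
    by rewrite (_ : [set _ | _] = setT) ?cardsT ?oF //; apply/setP => x; rewrite !inE eqxx.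
Qed.
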